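(* Let $\mathcal E: q\mapsto\phi_q$ ($q\in Q$) be a modalised system of equations. Then $\bigwedge_{q\in Q}\boxdot^\bullet(q\leftrightarrow\phi_q)\vdash_{\mathsf{CHL}}\bigwedge_{q\in Q}(q\leftrightarrow\digamma_{\!q}\,\mathcal E)$.
   Context: Cyclic formulas. Labels: $\bot,\top$ and propositional variables (arity 0), $\neg,\Box$ (arity 1), $\wedge,\vee,\to$ (arity 2). A graph is $\langle V,r,S,\lambda\rangle$ with $V$ finite, root $r$, labelling $\lambda$, and $S:V\to V^{*}$ giving ordered successors (length = arity of label), $S_i(a)$ the $i$-th; every vertex reachable from $r$. A cycle is a set of pairwise distinct vertices $a_0,\dots,a_{k-1}$ with $a_{j+1}$ a successor of $a_j$ and $a_0$ a successor of $a_{k-1}$. A (cyclic) formula is a graph in which every cycle contains a $\Box$-labelled vertex. Bisimulation $R$: $aRa'$ implies equal labels and $S_i(a)RS'_i(a')$; $\phi\simeq\psi$ iff a bisimulation relates the roots. $\langle\Psi\rangle_a$ is the subgraph generated by $a$. $\phi$ is modalised in $p$ if every path from the root to a $p$-labelled vertex contains a $\Box$-labelled vertex; $\digamma p.\phi$ identifies the root with all $p$-labelled vertices (keeping the root's label). $\mathsf{CHL}$: the least set of cyclic formulas containing all substitution instances of propositional tautologies, all $\Box(\phi\to\psi)\to(\Box\phi\to\Box\psi)$, all $\phi\leftrightarrow\psi$ with $\phi\simeq\psi$, closed under modus ponens, necessitation and Löb's rule (from $\vdash\Box\phi\to\phi$ infer $\vdash\phi$). $\Gamma\vdash_{\mathsf{CHL}}\phi$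 means $\mathsf{CHL}\vdash\bigwedge\Gamma\to\phi$. $\Box^\bullet\phi:=\digamma p.\Box(\phi\wedge p)$ ($p$ not in $\phi$), $\boxdot^\bullet\phi:=\phi\wedge\Box^\bullet\phi$. Systems: a system of equations $\mathcal E$ is a function from a finite set $Q$ of variables to formulas $\phi_q$. ${\sf G}_{\mathcal E}$ is the directed graph on $Q$ with an arrow $q\to q'$ iff $\phi_q$ is not modalised in $q'$; $\mathcal E$ is modalised iff ${\sf G}_{\mathcal E}$ is acyclic. ${\sf G}^\circ_{\mathcal E}$ has an arrow $q\to q'$ iff the root of $\phi_q$ is labelled $q'$; ${\sf end}(q)$ is the last node of the maximal path from $q$ in ${\sf G}^\circ_{\mathcal E}$. The unrooted graph $\Psi$: vertices are pairs $\langle\phi_q,a\rangle$ with $q\in Q$, $a$ a vertex of $\phi_q$ with label not in $Q$; label $\lambda_{\phi_q}(a)$. ${\sf idfy}(\langle\phi_q,a\rangle):=\langle\phi_{{\sf end}(q')},r_{\phi_{{\sf end}(q')}}\rangle$ if $a$ is labelled $q'\in Q$, and $:=\langle\phi_q,a\rangle$ otherwise. If $S_{\phi_q}a=\langle b_0,\dots,b_{n-1}\rangle$ then $S_\Psi\langle\phi_q,a\rangle:=\langle{\sf idfy}\langle\phi_q,b_0\rangle,\dots,{\sf idfy}\langle\phi_q,b_{n-1}\rangle\rangle$. $\mathfrak r_q:={\sf idfy}\langle\phi_q,r_{\phi_q}\rangle$ and $\digamma_{\!q}\,\mathcal E:=\langle\Psi\rangle_{\mathfrak r_q}$. *)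

(* Defs.v *)
From HB Require Import structures.
From mathcomp Require Import all_boot finmap.

Set Implicit Arguments.
Unset Strict Implicit.
Unset Printing Implicit Defensive.

Inductive label : Type :=
  | LBot | LTop | LVar of nat | LNeg | LBox | LAnd | LOr | LImp.

Definition arity (l : label) : nat :=
  match l with
  | LBot | LTop | LVar _ => 0
  | LNeg | LBox => 1
  | LAnd | LOr | LImp => 2
  end.

Definition label_eqb (l l' : label) : bool :=
  match l, l' with
  | LBot, LBot | LTop, LTop | LNeg, LNeg | LBox, LBox
  | LAnd, LAnd | LOr, LOr | LImp, LImp => true
  | LVar p, LVar q => p == q
  | _, _ => false
  end.

Lemma label_eqbP : Equality.axiom label_eqb.
Proof.
case=> [||p|||||] [||q|||||] /=; try by constructor.
by apply: (iffP eqP) => [-> | []].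
Qed.

HB.instance Definition _ := hasDecEq.Build label label_eqbP.

(* Unrooted graphs; a graph adds a root from which every vertex is reachable. *)
Record ugraph := UGraph {
  vertex :> finType;
  lab : vertex -> label;
  osucc : vertex -> seq vertex;
  size_osucc : forall a, size (osucc a) = arity (lab a) }.

Definition edge (G : ugraph) : rel G := fun a b => b \in osucc a.

Definition is_box (G : ugraph) (a : G) : bool := lab a == LBox.

Definition guarded (G : ugraph) : Prop :=
  forall c : seq G, c != [::] -> ucycle (@edge G) c -> has (@is_box G) c.

Record graph := Graph {
  base :> ugraph;
  root : base;
  root_connect : forall a : base, connect (@edge base) root a }.

Record formula := Formula {
  fgraph :> graph;
  fguarded : guarded fgraph }.

Arguments fguarded : clear implicits.

Definition bisimulation (G G' : ugraph) (R : G -> G' -> Prop) : Prop :=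
  forall a a', R a a' ->
    lab a = lab a' /\
    (forall i, i < arity (lab a) -> R (nth a (osucc a) i) (nth a' (osucc a') i)).

Definition bisimilar (phi psi : graph) : Prop :=
  exists R : phi -> psi -> Prop, bisimulation R /\ R (root phi) (root psi).

(* Both endpoints of the path count: a [LBox]-labelled root suffices, and a
   formula whose root is labelled p is not modalised in p. *)
Definition modalised (phi : graph) (p : nat) : Prop :=
  forall s : seq phi, path (@edge phi) (root phi) s ->
    lab (last (root phi) s) = LVar p -> has (@is_box phi) (root phi :: s).

Section Rank.
Variables (T : finType) (e : rel T).

Definition acyclic : Prop := forall c : seq T, ucycle e c -> c = [::].

Definition drank (x : T) : nat := #|[pred y | connect e x y]|.

Lemma drank_connect x y : connect e x y -> drank y <= drank x.
Proof.
move=> xy; apply: subset_leq_card; apply/subsetP => z; rewrite !inE.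
exact: connect_trans xy.
Qed.

Lemma acyclic_back : acyclic -> forall x y, e x y -> ~~ connect e y x.
Proof.
move=> ac x y exy; apply/negP => /connectP[p pp xE].
move: xE; case/shortenP: pp => p' pp' up' _ xE.
suff : y :: p' = [::] by [].
by apply: ac; rewrite /ucycle up' andbT /= rcons_path pp' -xE.
Qed.

Lemma drank_edge : acyclic -> forall x y, e x y -> drank y < drank x.
Proof.
move=> ac x y exy; apply: proper_card; apply/properP; split.
  apply/subsetP => z; rewrite !inE; exact: connect_trans (connect1 exy).
exists x; first by rewrite inE connect0.
by rewrite inE (acyclic_back ac).
Qed.

Lemma rank_path (f : T -> nat) : (forall x y, e x y -> f y < f x) ->
  forall p x, path e x p -> f (last x p) + size p <= f x.
Proof.
move=> fe; elim=> [|y p IH] x /=; first by rewrite addn0.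
by case/andP=> /fe lt_yx /IH le_y; rewrite addnS; apply: leq_ltn_trans le_y _.
Qed.

Lemma rank_acyclic (f : T -> nat) : (forall x y, e x y -> f y < f x) ->
  forall c, cycle e c -> c = [::].
Proof.
move=> fe [|x p] //= /(rank_path fe).
by rewrite last_rcons size_rcons addnS ltnNge leq_addr.
Qed.

End Rank.

Section Guarded.
Variable G : ugraph.

Definition ubedge : rel G := fun a b => edge a b && ~~ is_box a.

Lemma guardedP : guarded G <-> acyclic ubedge.
Proof.
split=> [gG c /andP[cyc uc] | ac c cN0 /andP[cyc uc]].
  apply/eqP; apply: contraT => cN0.
  have sub : cycle (@edge G) c.
    by apply: sub_cycle cyc => x y /andP[].
  have := gG c cN0; rewrite /ucycle sub uc => /(_ isT) /hasP[x xc bx].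
  by have /andP[_] := next_cycle cyc xc; rewrite bx.
apply: contraT => /hasPn nb; case/eqP: cN0; apply: ac; rewrite /ucycle uc andbT.
apply: (sub_in_cycle _ _ cyc (P := [in c])) => [x y xc _ exy|]; last exact/allP.
by rewrite /ubedge exy; apply: nb.
Qed.

Lemma rank_guarded (f : G -> nat) :
  (forall a b, edge a b -> ~~ is_box a -> f b < f a) -> guarded G.
Proof.
move=> fe; apply/guardedP => c /andP[cyc _].
by apply: (rank_acyclic (f := f)) cyc => x y /andP[]; apply: fe.
Qed.

Lemma guarded_rank : guarded G ->
  forall a b, edge a b -> ~~ is_box a -> drank ubedge b < drank ubedge a.
Proof.
move=> /guardedP ac a b eab nb; apply: (drank_edge ac).
by rewrite /ubedge eab nb.
Qed.

End Guarded.

(* Boolean form of [modalised], see [modalisedP]; needed for [rel]-valued [dep_rel]. *)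
Definition modalisedb (phi : graph) (p : nat) : bool :=
  [forall a : phi, (lab a == LVar p) ==> ~~ connect (@ubedge phi) (root phi) a].

Lemma modalisedP (phi : graph) (p : nat) :
  reflect (modalised phi p) (modalisedb phi p).
Proof.
apply: (iffP forallP) => [H s ps /eqP ls | H a].
  have /implyP/(_ ls) := H (last (root phi) s); apply: contraNT => /hasPn nb.
  apply/connectP; exists s => //.
  apply: (sub_in_path _ _ ps (P := [in root phi :: s])); last exact/allP.
  by move=> x y xs _ exy; rewrite /ubedge exy; apply: nb.
apply/implyP => /eqP la; apply/negP => /connectP[s ps aE].
have pe : path (@edge phi) (root phi) s by apply: sub_path ps => x y /andP[].
have := H s pe; rewrite -aE la => /(_ erefl).
have nba : ~~ is_box a by rewrite /is_box la.
apply/negP; rewrite aE in nba; clear - ps nba.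
elim: s (root phi) ps nba => [|y s IH] x /=; first by rewrite orbF.
by case/andP=> /andP[_ nbx] ps nbl; rewrite (negPf nbx) /= (IH y ps nbl).
Qed.

Section Generated.
Variables (G : ugraph) (a : G).

Definition gen_vertex : finType := {b : G | connect (@edge G) a b}.

Lemma gen_closed (x : gen_vertex) (b : G) :
  b \in osucc (val x) -> connect (@edge G) a b.
Proof. by move=> bx; apply: connect_trans (valP x) (connect1 bx). Qed.

Definition gen_osucc (x : gen_vertex) : seq gen_vertex :=
  pmap insub (osucc (val x)).

Lemma val_gen_osucc (x : gen_vertex) : map val (gen_osucc x) = osucc (val x).
Proof.
rewrite /gen_osucc (pmap_filter (@insubK _ _ _)).
by apply/all_filterP/allP => b /gen_closed; rewrite isSome_insub.
Qed.

Lemma gen_size (x : gen_vertex) : size (gen_osucc x) = arity (lab (val x)).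
Proof. by rewrite -(size_map val) val_gen_osucc size_osucc. Qed.

Definition gen_ugraph : ugraph := UGraph gen_size.

Lemma gen_edge (x y : gen_ugraph) : edge x y = edge (val x) (val y).
Proof.
by rewrite /edge -val_gen_osucc (mem_map val_inj).
Qed.

Definition gen_root : gen_ugraph := Sub a (connect0 _ a).

Lemma gen_connect (x : gen_ugraph) : connect (@edge gen_ugraph) gen_root x.
Proof.
case/connectP: (valP x) => p; elim/last_ind: p x => [|p b IH] x.
  by move=> _ /= xa; have -> : x = gen_root by apply: val_inj.
rewrite rcons_path last_rcons => /andP[pp eb] xb.
have cl : connect (@edge G) a (last a p) by apply/connectP; exists p.
apply: connect_trans (IH (Sub (last a p) cl) pp erefl) (connect1 _).
by rewrite gen_edge xb.
Qed.

Definition generated : graph := Graph gen_connect.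

Lemma gen_guarded : guarded G -> guarded generated.
Proof.
move=> gG; apply: (@rank_guarded gen_ugraph (fun x => drank (@ubedge G) (val x))).
by move=> x y; rewrite gen_edge; apply: guarded_rank.
Qed.

End Generated.

Section Atom.
Variable l : label.
Hypothesis l0 : arity l = 0.

Definition atom_ugraph : ugraph :=
  @UGraph unit (fun _ => l) (fun _ => [::]) (fun _ => esym l0).

Lemma atom_connect (a : atom_ugraph) : connect (@edge atom_ugraph) tt a.
Proof. by case: a; apply: connect0. Qed.

Definition atom_graph : graph := Graph atom_connect.

Lemma atom_guarded : guarded atom_graph.
Proof. exact: (@rank_guarded atom_ugraph (fun _ => 0)). Qed.

Definition atom : formula := Formula atom_guarded.
End Atom.

Section Unary.
Variables (l : label) (phi : formula).
Hypothesis l1 : arity l = 1.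

Definition un_lab (x : option phi) : label := if x is Some a then lab a else l.
Definition un_osucc (x : option phi) : seq (option phi) :=
  if x is Some a then map Some (osucc a) else [:: Some (root phi)].

Lemma un_size x : size (un_osucc x) = arity (un_lab x).
Proof. by case: x => [a|] //=; rewrite size_map size_osucc. Qed.

Definition un_ugraph : ugraph := UGraph un_size.

Lemma un_edge (a : phi) (y : option phi) :
  edge (Some a : un_ugraph) y = if y is Some b then edge a b else false.
Proof.
case: y => [b|]; rewrite /edge /=; first by rewrite (mem_map Some_inj).
by apply/mapP => -[].
Qed.

Lemma un_connect (x : un_ugraph) : connect (@edge un_ugraph) None x.
Proof.
case: x => [a|]; last exact: connect0.
apply: (@connect_trans _ _ (Some (root phi))).
  by apply: connect1; rewrite /edge inE.
case/connectP: (root_connect a) => p; elim: p (root phi) => [|b p IH] r /=.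
  by move=> _ ->; apply: connect0.
case/andP=> erb pp aE; apply: connect_trans (IH b pp aE); apply: connect1.
by rewrite un_edge.
Qed.

Definition un_graph : graph := Graph un_connect.

Lemma un_guarded : guarded un_graph.
Proof.
pose f (x : option phi) :=
  if x is Some a then drank (@ubedge phi) a else (#|phi|).+1.
apply: (@rank_guarded un_ugraph f) => -[a|] y.
  by rewrite un_edge; case: y => // b; apply: guarded_rank; apply: fguarded.
by rewrite /edge inE => /eqP-> _; rewrite ltnS; apply: max_card.
Qed.

Definition un : formula := Formula un_guarded.
End Unary.

Section Binary.
Variables (l : label) (phi psi : formula).
Hypothesis l2 : arity l = 2.

Definition bin_lab (x : option (phi + psi)) : label :=
  match x with
  | Some (inl a) => lab a
  | Some (inr a) => lab a
  | None => l
  end.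
Definition bin_osucc (x : option (phi + psi)) : seq (option (phi + psi)) :=
  match x with
  | Some (inl a) => [seq Some (inl b) | b <- osucc a]
  | Some (inr a) => [seq Some (inr b) | b <- osucc a]
  | None => [:: Some (inl (root phi)); Some (inr (root psi))]
  end.

Lemma bin_size x : size (bin_osucc x) = arity (bin_lab x).
Proof. by case: x => [[a|a]|] //=; rewrite size_map size_osucc. Qed.

Definition bin_ugraph : ugraph := UGraph bin_size.

Lemma bin_edgel (a : phi) (y : option (phi + psi)) :
  edge (Some (inl a) : bin_ugraph) y =
  if y is Some (inl b) then edge a b else false.
Proof.
have inj : injective (fun b : phi => Some (inl b) : option (phi + psi)).
  by move=> ? ? [].
by case: y => [[b|b]|]; rewrite /edge /= ?(mem_map inj) //; apply/mapP => -[].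
Qed.

Lemma bin_edger (a : psi) (y : option (phi + psi)) :
  edge (Some (inr a) : bin_ugraph) y =
  if y is Some (inr b) then edge a b else false.
Proof.
have inj : injective (fun b : psi => Some (inr b) : option (phi + psi)).
  by move=> ? ? [].
by case: y => [[b|b]|]; rewrite /edge /= ?(mem_map inj) //; apply/mapP => -[].
Qed.

Lemma bin_connect (x : bin_ugraph) : connect (@edge bin_ugraph) None x.
Proof.
case: x => [[a|a]|]; last exact: connect0.
  apply: (@connect_trans _ _ (Some (inl (root phi)))).
    by apply: connect1; rewrite /edge !inE eqxx.
  case/connectP: (root_connect a) => p; elim: p (root phi) => [|b p IH] r /=.
    by move=> _ ->; apply: connect0.
  case/andP=> erb pp aE; apply: connect_trans (IH b pp aE); apply: connect1.
  by rewrite bin_edgel.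
apply: (@connect_trans _ _ (Some (inr (root psi)))).
  by apply: connect1; rewrite /edge !inE eqxx orbT.
case/connectP: (root_connect a) => p; elim: p (root psi) => [|b p IH] r /=.
  by move=> _ ->; apply: connect0.
case/andP=> erb pp aE; apply: connect_trans (IH b pp aE); apply: connect1.
by rewrite bin_edger.
Qed.

Definition bin_graph : graph := Graph bin_connect.

Lemma bin_guarded : guarded bin_graph.
Proof.
pose f (x : option (phi + psi)) := match x with
  | Some (inl a) => drank (@ubedge phi) a
  | Some (inr a) => drank (@ubedge psi) a
  | None => (#|phi| + #|psi|).+1
  end.
apply: (@rank_guarded bin_ugraph f) => -[[a|a]|] y.
- by rewrite bin_edgel; case: y => // -[] // b; apply/guarded_rank/fguarded.
- by rewrite bin_edger; case: y => // -[] // b; apply/guarded_rank/fguarded.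
rewrite /edge !inE => /orP[] /eqP-> _; rewrite ltnS.
  by apply: leq_trans (leq_addr _ _); apply: max_card.
by apply: leq_trans (leq_addl _ _); apply: max_card.
Qed.

Definition bin : formula := Formula bin_guarded.
End Binary.

Definition fBot : formula := @atom LBot erefl.
Definition fTop : formula := @atom LTop erefl.
Definition fVar (p : nat) : formula := @atom (LVar p) erefl.
Definition fNeg (phi : formula) : formula := @un LNeg phi erefl.
Definition fBox (phi : formula) : formula := @un LBox phi erefl.
Definition fAnd (phi psi : formula) : formula := @bin LAnd phi psi erefl.
Definition fOr (phi psi : formula) : formula := @bin LOr phi psi erefl.
Definition fImp (phi psi : formula) : formula := @bin LImp phi psi erefl.
Definition fIff (phi psi : formula) : formula :=
  fAnd (fImp phi psi) (fImp psi phi).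

Definition fConj (Gamma : seq formula) : formula := foldr fAnd fTop Gamma.

Inductive pform : Type :=
  | PVar of nat | PBot | PTop | PNeg of pform
  | PAnd of pform & pform | POr of pform & pform | PImp of pform & pform.

Fixpoint peval (v : nat -> bool) (t : pform) : bool :=
  match t with
  | PVar n => v n
  | PBot => false
  | PTop => true
  | PNeg t => ~~ peval v t
  | PAnd t u => peval v t && peval v u
  | POr t u => peval v t || peval v u
  | PImp t u => peval v t ==> peval v u
  end.

Definition tautology (t : pform) : Prop := forall v, peval v t.

Fixpoint psubst (sigma : nat -> formula) (t : pform) : formula :=
  match t with
  | PVar n => sigma n
  | PBot => fBot
  | PTop => fTop
  | PNeg t => fNeg (psubst sigma t)
  | PAnd t u => fAnd (psubst sigma t) (psubst sigma u)
  | POr t u => fOr (psubst sigma t) (psubst sigma u)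
  | PImp t u => fImp (psubst sigma t) (psubst sigma u)
  end.

(* Tautologies are box-free trees; tautologies with sharing are then obtained
   through [CHL_bisim]. *)
Inductive CHL : formula -> Prop :=
  | CHL_taut t sigma : tautology t -> CHL (psubst sigma t)
  | CHL_K phi psi :
      CHL (fImp (fBox (fImp phi psi)) (fImp (fBox phi) (fBox psi)))
  | CHL_bisim (phi psi : formula) : bisimilar phi psi -> CHL (fIff phi psi)
  | CHL_MP phi psi : CHL (fImp phi psi) -> CHL phi -> CHL psi
  | CHL_nec phi : CHL phi -> CHL (fBox phi)
  | CHL_Loeb phi : CHL (fImp (fBox phi) phi) -> CHL phi.

Definition CHL_entails (Gamma : seq formula) (phi : formula) : Prop :=
  CHL (fImp (fConj Gamma) phi).

(* The identification is realised by deleting the p-labelled vertices (they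
   have no successors) and redirecting the edges into them to the root. *)
Section Digamma.
Variables (p : nat) (phi : formula).
Hypothesis mod_phi : modalised phi p.

Definition dig_vertex : finType := {a : phi | lab a != LVar p}.

Lemma dig_root_subproof : lab (root phi) != LVar p.
Proof.
apply/eqP => lr; have := mod_phi (s := [::]) isT lr.
by rewrite /= orbF /is_box lr.
Qed.

Definition dig_root : dig_vertex := Sub (root phi) dig_root_subproof.
Definition dig_idfy (a : phi) : dig_vertex := insubd dig_root a.
Definition dig_osucc (x : dig_vertex) : seq dig_vertex :=
  map dig_idfy (osucc (val x)).

Lemma dig_size (x : dig_vertex) : size (dig_osucc x) = arity (lab (val x)).
Proof. by rewrite size_map size_osucc. Qed.

Definition dig_ugraph : ugraph := UGraph dig_size.

Lemma dig_idfyE (x : dig_vertex) : dig_idfy (val x) = x.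
Proof. exact: valKd. Qed.

Lemma dig_idfy_connect (a : phi) :
  connect (@edge dig_ugraph) dig_root (dig_idfy a).
Proof.
case/connectP: (root_connect a) => s; elim/last_ind: s a => [|s b IH] a.
  by move=> _ /= ->; rewrite -[root phi]/(val dig_root) dig_idfyE connect0.
rewrite rcons_path last_rcons => /andP[ps elb] ->.
apply: connect_trans (IH _ ps erefl) (connect1 _).
rewrite /edge /= /dig_osucc; apply: map_f.
rewrite /dig_idfy val_insubd; case: ifP => // /negbFE/eqP ll.
by move: elb; rewrite /edge; move: (size_osucc (last (root phi) s));
  rewrite ll; case: (osucc _).
Qed.

Lemma dig_connect (x : dig_ugraph) : connect (@edge dig_ugraph) dig_root x.
Proof. by rewrite -(dig_idfyE x) dig_idfy_connect. Qed.

Definition dig_graph : graph := Graph dig_connect.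

Lemma dig_guarded : guarded dig_graph.
Proof.
pose R0 (a : phi) := connect (@ubedge phi) (root phi) a.
pose f (x : dig_vertex) :=
  (if R0 (val x) then 0 else (#|phi|).+1) + drank (@ubedge phi) (val x).
have f0 : forall x : dig_vertex, R0 (val x) -> f x <= #|phi|.
  by move=> x; rewrite /f => ->; apply: max_card.
apply: (@rank_guarded dig_ugraph f) => x y /mapP[b eb ->] nb.
have nbx : ~~ @is_box phi (val x) by [].
have lt_b := guarded_rank (fguarded phi) (eb : edge (val x) b) nbx.
have R0b : R0 (val x) -> R0 b.
  by move=> /connect_trans; apply; apply: connect1; rewrite /ubedge nbx andbT.
have [lb|lb] := boolP (lab b == LVar p).
  have Rx : ~~ R0 (val x).
    apply/negP => /R0b Rb; move/modalisedP/forallP/(_ b): mod_phi.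
    by rewrite lb -/(R0 b) Rb.
  have -> : dig_idfy b = dig_root by rewrite /dig_idfy /insubd insubF // lb.
  apply: leq_ltn_trans (f0 dig_root (connect0 _ _)) _.
  by rewrite /f (negPf Rx) addSn ltnS leq_addr.
have vb : val (dig_idfy b) = b by rewrite /dig_idfy val_insubd lb.
have [Rx|Rx] := boolP (R0 (val x)).
  by rewrite /f vb Rx (R0b Rx).
have [Rb|Rb] := boolP (R0 b).
  apply: leq_ltn_trans (f0 _ _) _; first by rewrite vb.
  by rewrite /f (negPf Rx) addSn ltnS leq_addr.
by rewrite /f vb (negPf Rx) (negPf Rb) ltn_add2l.
Qed.

Definition digamma : formula := Formula dig_guarded.
End Digamma.

Definition fresh (phi : graph) : nat :=
  (\max_(a : phi) (if lab a is LVar n then n else 0)).+1.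

Lemma fresh_notin (phi : graph) (a : phi) : lab a != LVar (fresh phi).
Proof.
apply/eqP => la; pose F (b : phi) := if lab b is LVar n then n else 0.
by have := leq_bigmax (F := F) a; rewrite {1}/F la /fresh ltnn.
Qed.

Lemma modalised_box (phi : formula) (p : nat) : modalised (fBox phi) p.
Proof. by []. Qed.

Definition boxbul (phi : formula) : formula :=
  digamma (@modalised_box (fAnd phi (fVar (fresh phi))) (fresh phi)).

Definition boxdotbul (phi : formula) : formula := fAnd phi (boxbul phi).

Definition system (Q : {fset nat}) : Type := Q -> formula.

Section System.
Variables (Q : {fset nat}) (E : system Q).

Definition dep_rel : rel Q := fun q q' => ~~ modalisedb (E q) (val q').

Definition modalised_system : Prop := acyclic dep_rel.

Definition root_rel : rel Q := fun q q' => lab (root (E q)) == LVar (val q').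

(* [root_rel] is functional (lemma [root_rel_fun]), so there is at most one such
   e; lemma [sys_endP] gives existence.  The default q is never used when the
   system is modalised. *)
Definition sys_end (q : Q) : Q :=
  odflt q [pick e | connect root_rel q e & [forall q', ~~ root_rel e q']].

Definition qlabel (l : label) : option Q := if l is LVar n then insub n else None.

Definition sys_occ : finType := {q : Q & E q}.
Definition occ_lab (x : sys_occ) : label := lab (tagged x).
Definition occ_root (q : Q) : sys_occ := Tagged (fun q : Q => E q) (root (E q)).

(* Vertices of Psi are indexed by q itself rather than by the formula E q, so
   that equations with equal right-hand sides contribute disjoint copies. *)
Definition sys_vertex : finType := {x : sys_occ | qlabel (occ_lab x) == None}.

Definition idfy_occ (x : sys_occ) : sys_occ :=
  if qlabel (occ_lab x) is Some q' then occ_root (sys_end q') else x.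

Lemma qlabelP (l : label) (q : Q) : reflect (l = LVar (val q)) (qlabel l == Some q).
Proof.
apply: (iffP eqP) => [|->]; last by rewrite /= valK.
case: l => //= n; case: insubP => // u _ <- [->] //.
Qed.

Lemma root_dep q q' : root_rel q q' -> dep_rel q q'.
Proof.
move=> rqq; apply/forallPn; exists (root (E q)).
by rewrite -/(root_rel q q') rqq connect0.
Qed.

Lemma root_rel_fun q q1 q2 : root_rel q q1 -> root_rel q q2 -> q1 = q2.
Proof. by rewrite /root_rel => /eqP -> /eqP[/val_inj]. Qed.

Hypothesis mod_E : modalised_system.

Lemma sys_endP q :
  connect root_rel q (sys_end q) /\ forall q', ~~ root_rel (sys_end q) q'.
Proof.
rewrite /sys_end; case: pickP => [e /andP[ce /forallP me] //|] no; exfalso.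
have [n le_n] := ubnP (drank dep_rel q).
elim: n q no le_n => // n IH q no le_n.
have := no q; rewrite connect0 => /negbT/forallPn[q' /negPn rqq].
apply: (IH q') => [e|].
  apply: contraFF (no e) => /andP[ce ->]; rewrite andbT.
  exact: connect_trans (connect1 rqq) ce.
exact: leq_trans (drank_edge mod_E (root_dep rqq)) le_n.
Qed.

Lemma idfy_subproof (x : sys_occ) : qlabel (occ_lab (idfy_occ x)) == None.
Proof.
rewrite /idfy_occ; case ql: (qlabel (occ_lab x)) => [q'|]; last by rewrite ql.
case ql': (qlabel _) => [q''|] //.
move/eqP/qlabelP/eqP: ql' => H.
by have [_ /(_ q'')] := sys_endP q'; rewrite /root_rel H.
Qed.

Definition idfy (x : sys_occ) : sys_vertex := Sub (idfy_occ x) (idfy_subproof x).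

Definition sys_osucc (x : sys_vertex) : seq sys_vertex :=
  [seq idfy (Tagged (fun q : Q => E q) b) | b <- osucc (tagged (val x))].

Lemma sys_size (x : sys_vertex) : size (sys_osucc x) = arity (occ_lab (val x)).
Proof. by rewrite size_map size_osucc. Qed.

Definition Psi : ugraph := UGraph sys_size.

Definition sys_root (q : Q) : Psi := idfy (occ_root q).

Lemma Psi_guarded : guarded Psi.
Proof.
pose M := (\max_(q : Q) #|E q|).+1.
have ltM q (a : E q) : drank (@ubedge (E q)) a < M.
  rewrite ltnS; apply: leq_trans (leq_bigmax q); exact: max_card.
pose R0 (x : sys_occ) := connect (@ubedge (E (tag x))) (root _) (tagged x).
pose h (x : sys_occ) := if R0 x then drank dep_rel (tag x) else (#|{: Q}|).+1.
pose f (x : sys_occ) := h x * M + drank (@ubedge (E (tag x))) (tagged x).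
have lex x y : h y < h x -> f y < f x.
  move=> lt_h; apply: (@leq_trans (h x * M)); last exact: leq_addr.
  apply: (@leq_trans ((h y).+1 * M)); last by rewrite leq_mul2r lt_h orbT.
  by rewrite mulSn /f addnC ltn_add2r; apply: ltM.
apply: (@rank_guarded Psi (fun x => f (val x))) => -[[q a] /= qa] y.
case/mapP=> /= b eb -> nba; rewrite /= /idfy_occ.
have nba' : ~~ @is_box (E q) a by [].
set xa : sys_occ := Tagged (fun q : Q => E q) a.
set xb : sys_occ := Tagged (fun q : Q => E q) (b : E q).
have lt_b := guarded_rank (fguarded (E q)) (eb : edge a b) nba'.
have R0b : R0 xa -> R0 xb.
  by move=> /connect_trans; apply; apply: connect1; rewrite /ubedge nba' andbT.
case ql: (qlabel (occ_lab xb)) => [q'|].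
  move/eqP/qlabelP: ql => lb.
  apply: lex; rewrite /h {1}/R0 connect0 /=.
  case: ifP => [Ra|_]; last by rewrite ltnS; apply: max_card.
  have dqq : dep_rel q q'.
    apply/forallPn; exists b; rewrite negb_imply negbK.
    by apply/andP; split; [apply/eqP | apply: R0b].
  apply: leq_ltn_trans (drank_edge mod_E dqq); apply: drank_connect.
  have [ce _] := sys_endP q'; apply: connect_sub ce => u v ruv.
  exact/connect1/root_dep.
have [Ra|Ra] := boolP (R0 xa).
  by rewrite /f /h Ra (R0b Ra) /= ltn_add2l.
have [Rb|Rb] := boolP (R0 xb).
  by apply: lex; rewrite /h (negPf Ra) Rb ltnS; apply: max_card.
by rewrite /f /h (negPf Ra) (negPf Rb) ltn_add2l.
Qed.

Definition sys_digamma (q : Q) : formula :=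
  Formula (@gen_guarded Psi (sys_root q) Psi_guarded).

End System.

(* Main.v *)
(* Write H for the conjunction of the hypotheses and, for an occurrence x of a
   vertex a in the formula E q, compare the subformula A_x of E q generated by
   a with the subformula B_x of Psi generated by idfy x.  Let D be the
   conjunction of all equivalences A_x <-> B_x.  Then H and []D imply D, by
   induction on the occurrences along the edges that leave non-box vertices and
   the jumps from a vertex labelled q' to the root of E q'; this relation is
   well founded because E is modalised.  At a box vertex one uses []D, at a
   vertex labelled q' the equivalence of q' and E q' contained in H.  As H
   implies []H, Loeb's rule applied to H -> D yields D from H. *)

Require Import Defs.
From mathcomp Require Import all_boot finmap.

Set Implicit Arguments.
Unset Strict Implicit.
Unset Printing Implicit Defensive.

(** * Propositional reasoning in [CHL] under a hypothesis *)

Definition ded (H phi : formula) : Prop := CHL (fImp H phi).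

(** Truth tables: the schemas below have at most four variables, so splitting on [v 0] to [v 4]
    decides them. *)
Ltac taut :=
  let v := fresh "v" in
  move=> v /=; move: (v 0) (v 1) (v 2) (v 3) (v 4) => [] [] [] [] [].

Lemma ded_mp H phi psi : ded H (fImp phi psi) -> ded H phi -> ded H psi.
Proof.
move=> h1; apply: CHL_MP; apply: CHL_MP h1.
exact: (@CHL_taut (PImp (PImp (PVar 0) (PImp (PVar 1) (PVar 2)))
  (PImp (PImp (PVar 0) (PVar 1)) (PImp (PVar 0) (PVar 2))))
  (nth fTop [:: H; phi; psi]) ltac:(taut)).
Qed.

Lemma ded_weak H phi : CHL phi -> ded H phi.
Proof.
apply: CHL_MP; exact: (@CHL_taut (PImp (PVar 0) (PImp (PVar 1) (PVar 0)))
  (nth fTop [:: phi; H]) ltac:(taut)).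
Qed.

Lemma ded_id H : ded H H.
Proof.
exact: (@CHL_taut (PImp (PVar 0) (PVar 0)) (nth fTop [:: H]) ltac:(taut)).
Qed.

Lemma ded_taut H t l : tautology t -> ded H (psubst (nth fTop l) t).
Proof. by move=> tt; apply/ded_weak/CHL_taut. Qed.

Lemma ded_cut H phi psi : ded H phi -> ded phi psi -> ded H psi.
Proof. by move=> h1 /(ded_weak H) /ded_mp; apply. Qed.

Lemma ded_andI H phi psi : ded H phi -> ded H psi -> ded H (fAnd phi psi).
Proof.
move=> h1; apply: ded_mp; apply: ded_mp h1.
exact: (@ded_taut H (PImp (PVar 0) (PImp (PVar 1) (PAnd (PVar 0) (PVar 1))))
  [:: phi; psi] ltac:(taut)).
Qed.

Lemma ded_andl phi psi : ded (fAnd phi psi) phi.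
Proof.
exact: (@CHL_taut (PImp (PAnd (PVar 0) (PVar 1)) (PVar 0))
  (nth fTop [:: phi; psi]) ltac:(taut)).
Qed.

Lemma ded_andr phi psi : ded (fAnd phi psi) psi.
Proof.
exact: (@CHL_taut (PImp (PAnd (PVar 0) (PVar 1)) (PVar 1))
  (nth fTop [:: phi; psi]) ltac:(taut)).
Qed.

Lemma ded_impI H phi psi : ded (fAnd H phi) psi -> ded H (fImp phi psi).
Proof.
apply: CHL_MP; exact: (@CHL_taut (PImp (PImp (PAnd (PVar 0) (PVar 1)) (PVar 2))
  (PImp (PVar 0) (PImp (PVar 1) (PVar 2))))
  (nth fTop [:: H; phi; psi]) ltac:(taut)).
Qed.

Lemma ded_bisim H (phi psi : formula) : bisimilar phi psi -> ded H (fIff phi psi).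
Proof. by move=> b; apply/ded_weak/CHL_bisim. Qed.

Lemma ded_iffI H phi psi :
  ded H (fImp phi psi) -> ded H (fImp psi phi) -> ded H (fIff phi psi).
Proof. exact: ded_andI. Qed.

Lemma ded_iff_mp H phi psi : ded H (fIff phi psi) -> ded H phi -> ded H psi.
Proof. by move=> h; apply: ded_mp; apply: ded_cut h (ded_andl _ _). Qed.

Lemma ded_iff_sym H phi psi : ded H (fIff phi psi) -> ded H (fIff psi phi).
Proof.
by move=> h; apply: ded_iffI; apply: ded_cut h _; [apply: ded_andr|apply: ded_andl].
Qed.

Lemma ded_iff_trans H phi psi chi :
  ded H (fIff phi psi) -> ded H (fIff psi chi) -> ded H (fIff phi chi).
Proof.
move=> h1; apply: ded_mp; apply: ded_mp h1.
pose iff s t := PAnd (PImp s t) (PImp t s).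
exact: (@ded_taut H (PImp (iff (PVar 0) (PVar 1)) (PImp (iff (PVar 1) (PVar 2))
  (iff (PVar 0) (PVar 2)))) [:: phi; psi; chi] ltac:(taut)).
Qed.

Lemma ded_iff_neg H phi psi :
  ded H (fIff phi psi) -> ded H (fIff (fNeg phi) (fNeg psi)).
Proof.
apply: ded_mp; pose iff s t := PAnd (PImp s t) (PImp t s).
exact: (@ded_taut H (PImp (iff (PVar 0) (PVar 1))
  (iff (PNeg (PVar 0)) (PNeg (PVar 1)))) [:: phi; psi] ltac:(taut)).
Qed.

Lemma ded_iff_and H phi psi phi' psi' :
  ded H (fIff phi phi') -> ded H (fIff psi psi') ->
  ded H (fIff (fAnd phi psi) (fAnd phi' psi')).
Proof.
move=> h1; apply: ded_mp; apply: ded_mp h1.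
pose iff s t := PAnd (PImp s t) (PImp t s).
exact: (@ded_taut H (PImp (iff (PVar 0) (PVar 1)) (PImp (iff (PVar 2) (PVar 3))
  (iff (PAnd (PVar 0) (PVar 2)) (PAnd (PVar 1) (PVar 3)))))
  [:: phi; phi'; psi; psi'] ltac:(taut)).
Qed.

Lemma ded_iff_or H phi psi phi' psi' :
  ded H (fIff phi phi') -> ded H (fIff psi psi') ->
  ded H (fIff (fOr phi psi) (fOr phi' psi')).
Proof.
move=> h1; apply: ded_mp; apply: ded_mp h1.
pose iff s t := PAnd (PImp s t) (PImp t s).
exact: (@ded_taut H (PImp (iff (PVar 0) (PVar 1)) (PImp (iff (PVar 2) (PVar 3))
  (iff (POr (PVar 0) (PVar 2)) (POr (PVar 1) (PVar 3)))))
  [:: phi; phi'; psi; psi'] ltac:(taut)).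
Qed.

Lemma ded_iff_imp H phi psi phi' psi' :
  ded H (fIff phi phi') -> ded H (fIff psi psi') ->
  ded H (fIff (fImp phi psi) (fImp phi' psi')).
Proof.
move=> h1; apply: ded_mp; apply: ded_mp h1.
pose iff s t := PAnd (PImp s t) (PImp t s).
exact: (@ded_taut H (PImp (iff (PVar 0) (PVar 1)) (PImp (iff (PVar 2) (PVar 3))
  (iff (PImp (PVar 0) (PVar 2)) (PImp (PVar 1) (PVar 3)))))
  [:: phi; phi'; psi; psi'] ltac:(taut)).
Qed.

(** * Normal modal reasoning and Loeb's rule under a hypothesis *)

Lemma ded_box_mono phi psi : ded phi psi -> ded (fBox phi) (fBox psi).
Proof. by move=> /CHL_nec; apply: CHL_MP; apply: CHL_K. Qed.

Lemma ded_boxK H phi psi :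
  ded H (fBox (fImp phi psi)) -> ded H (fBox phi) -> ded H (fBox psi).
Proof. by move=> h; apply: ded_mp; apply: ded_cut h (CHL_K _ _). Qed.

Lemma ded_box_and H phi psi :
  ded H (fBox phi) -> ded H (fBox psi) -> ded H (fBox (fAnd phi psi)).
Proof.
move=> h; apply: ded_boxK; apply: ded_cut h (ded_box_mono _).
exact/ded_impI/ded_id.
Qed.

Lemma ded_iff_box H phi psi :
  ded H (fBox (fIff phi psi)) -> ded H (fIff (fBox phi) (fBox psi)).
Proof.
move=> h; apply: ded_iffI; apply: ded_cut h _.
  exact: ded_cut (ded_box_mono (ded_andl _ _)) (CHL_K _ _).
exact: ded_cut (ded_box_mono (ded_andr _ _)) (CHL_K _ _).
Qed.

Lemma ded_conj (T : eqType) (F : T -> formula) H s :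
  (forall x, x \in s -> ded H (F x)) -> ded H (fConj (map F s)).
Proof.
elim: s => [|x s IH] h /=; first exact: (@ded_taut H PTop [::]).
apply: ded_andI; first by apply: h; rewrite mem_head.
by apply: IH => y ys; apply: h; rewrite inE ys orbT.
Qed.

Lemma ded_conjE (T : eqType) (F : T -> formula) s x :
  x \in s -> ded (fConj (map F s)) (F x).
Proof.
elim: s => //= y s IH; rewrite inE => /orP[/eqP->|/IH h]; first exact: ded_andl.
exact: ded_cut (ded_andr _ _) h.
Qed.

Lemma ded_box_conj (T : eqType) (F : T -> formula) H s :
  (forall x, x \in s -> ded H (fBox (F x))) -> ded H (fBox (fConj (map F s))).
Proof.
elim: s => [|x s IH] h /=.
  exact/ded_weak/CHL_nec/(@CHL_taut PTop (nth fTop [::])).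
apply: ded_box_and; first by apply: h; rewrite mem_head.
by apply: IH => y ys; apply: h; rewrite inE ys orbT.
Qed.

(** Loeb's rule is applied to [fImp H phi]: since [H] yields [fBox H], axiom K turns
    [fBox (fImp H phi)] into [fBox phi]. *)
Lemma ded_Loeb H phi :
  ded H (fBox H) -> ded (fAnd H (fBox phi)) phi -> ded H phi.
Proof.
move=> HH h; apply: CHL_Loeb; apply: ded_impI; apply: ded_cut h.
apply: ded_andI; first exact: ded_andr.
apply: ded_boxK (ded_andl _ _) _; exact: ded_cut (ded_andr _ _) HH.
Qed.

(** The loop of [boxbul phi] is unrolled once. This is what makes the hypotheses of the theorem
    imply their own necessitations. *)
Lemma boxbul_unfold phi :
  bisimilar (boxbul phi) (fBox (boxdotbul phi)).
Proof.
set p := fresh phi.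
(* Outside the inner copy of [boxbul phi], a vertex on the right is matched with its counterpart on
   the left; the inner copy is matched identically. *)
pose R (x : boxbul phi) (y : fBox (boxdotbul phi)) : Prop :=
  match y with
  | None => val x = None
  | Some None => val x = Some None
  | Some (Some (inl c)) => val x = Some (Some (inl c))
  | Some (Some (inr z)) => x = z
  end.
(* [dig_idfy] moves only vertices labelled [p], and freshness excludes these inside [phi]. *)
have idfyK (a : fBox (fAnd phi (fVar p))) : lab a != LVar p ->
    val (dig_idfy (@modalised_box (fAnd phi (fVar p)) p) a) = a.
  by move=> la; rewrite /dig_idfy val_insubd la.
exists R; split=> // x [[[c|z]|]|].
- case: x => x px /= xE; subst x; split=> // i /= lt_i.
  have lt_i' : i < size (osucc c) by rewrite size_osucc.
  rewrite /dig_osucc /= -!map_comp (nth_map c) // (nth_map c) //=.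
  by apply: idfyK; apply: fresh_notin.
- move=> /= ->; split=> // i lt_i.
  by rewrite -map_comp (nth_map z) // size_osucc.
- case: x => x px /= xE; subst x; split=> // -[|[|]] //= _.
    by apply: idfyK; apply: fresh_notin.
  (* The second conjunct is the leaf labelled [p]: [insubd] takes its default there, the root of
     [boxbul phi]. *)
  by rewrite /dig_idfy /insubd insubF //= eqxx.
- case: x => x px /= xE; subst x; split=> // -[|] //= _.
  exact: idfyK.
Qed.

(** * Generated subformulas and their decomposition at the root *)

Definition gen (G : ugraph) (gG : guarded G) (a : G) : formula :=
  Formula (@gen_guarded G a gG).

Lemma val_nth_gen (G : ugraph) (a : G) (x : generated a) i :
  val (nth x (osucc x) i) = nth (val x) (osucc (val x)) i.
Proof.
rewrite -[in RHS](val_gen_osucc x).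
have [lt_i|le_i] := ltnP i (size (osucc x)); first by rewrite (nth_map x).
by rewrite !nth_default // size_map.
Qed.

Section Generated.
Variables (G : ugraph) (gG : guarded G).

Lemma gen_atom (a : G) l (l0 : arity l = 0) :
  lab a = l -> bisimilar (gen gG a) (atom l0).
Proof.
move=> la; exists (fun x _ => val x = a); split=> // x y xa.
by rewrite /= xa la l0; split.
Qed.

(** The right side has a new root above the part generated by [b]. As [a] may recur in that part,
    the graphs need not be isomorphic; vertices over the same vertex of [G] are related, and the new
    root counts as lying over [a]. *)
Lemma gen_un (a b : G) l (l1 : arity l = 1) :
  lab a = l -> osucc a = [:: b] -> bisimilar (gen gG a) (un (gen gG b) l1).
Proof.
move=> la sa; pose R (x : gen gG a) (y : un (gen gG b) l1) : Prop :=
  if y is Some z then val x = val z else val x = a.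
exists R; split=> // x [z|] xE; rewrite -[lab x]/(lab (sval x)) [sval x]xE;
    split=> // i lt_i.
  rewrite (nth_map z) /=; last by rewrite gen_size.
  by rewrite (val_nth_gen x) (val_nth_gen z) xE.
have -> : i = 0 by move: lt_i; rewrite la l1; case: i.
by rewrite /R /= (val_nth_gen x) xE sa.
Qed.

Lemma gen_bin (a b c : G) l (l2 : arity l = 2) :
  lab a = l -> osucc a = [:: b; c] ->
  bisimilar (gen gG a) (bin (gen gG b) (gen gG c) l2).
Proof.
move=> la sa.
pose R (x : gen gG a) (y : bin (gen gG b) (gen gG c) l2) : Prop :=
  match y with
  | Some (inl z) => val x = val z
  | Some (inr z) => val x = val z
  | None => val x = a
  end.
exists R; split=> // x [[z|z]|] xE; rewrite -[lab x]/(lab (sval x)) [sval x]xE;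
    split=> // i lt_i.
- rewrite (nth_map z) /=; last by rewrite gen_size.
  by rewrite (val_nth_gen x) (val_nth_gen z) xE.
- rewrite (nth_map z) /=; last by rewrite gen_size.
  by rewrite (val_nth_gen x) (val_nth_gen z) xE.
have : i < 2 by rewrite -l2 -la.
by case: i {lt_i} => [|[|]] // _; rewrite /R /= (val_nth_gen x) xE sa.
Qed.

(** Every cycle meets a box, so a step from a non-box vertex lowers the number of vertices reachable
    along such steps. *)
Lemma guarded_ind (P : G -> Prop) :
  (forall a, (~~ is_box a -> forall b, edge a b -> P b) -> P a) ->
  forall a, P a.
Proof.
move=> step a; have [n] := ubnP (drank (@ubedge G) a).
elim: n a => // n IH a le_n; apply: step => nb b eab; apply: IH.
exact: leq_trans (guarded_rank gG eab nb) le_n.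
Qed.

End Generated.

Lemma gen_root_bisim (phi : formula) :
  bisimilar phi (gen (fguarded phi) (Defs.root phi)).
Proof.
exists (fun x y => x = val y); split=> // x y ->; split=> // i _.
by rewrite (val_nth_gen y).
Qed.

(** * Occurrences in a system and their images in [Psi] *)

Section System.
Variables (Q : {fset nat}) (E : system Q).
Hypothesis mod_E : modalised_system E.

(** A jump from a vertex labelled [q'] to the root of [E q'] need not lower the dependency rank when
    that vertex lies behind a box. Roots therefore come first, as only box-free paths matter for
    them. *)
Lemma occ_ind (P : forall q, E q -> Prop) :
  (forall q (a : E q), (~~ is_box a -> forall b, edge a b -> P q b) ->
    (forall q', lab a = LVar (val q') -> P q' (Defs.root (E q'))) -> P q a) ->
  forall q a, P q a.
Proof.
move=> step.
have Proot q : P q (Defs.root (E q)).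
  have [n] := ubnP (drank (dep_rel E) q); elim: n q => // n IH q le_n.
  (* Invariant: a box-free path leads from the root to [a]. A label [q'] at such an [a] shows that
     [E q] is not modalised in [q'], so the rank drops. *)
  suff : forall a : E q, connect (@ubedge (E q)) (Defs.root (E q)) a -> P q a.
    by apply; apply: connect0.
  apply: (guarded_ind (fguarded (E q))) => a IHa ca; apply: step.
    move=> nb b eab; apply: IHa => //; apply: connect_trans ca (connect1 _).
    by rewrite /ubedge eab nb.
  move=> q' la; apply: IH; apply: leq_trans (drank_edge mod_E _) le_n.
  by apply/forallPn; exists a; rewrite la eqxx ca.
(* Every jump now ends at a root, settled by [Proot]; the induction follows edges only. *)
move=> q; apply: (guarded_ind (fguarded (E q))) => a IHa.
by apply: step.
Qed.

(** [root_rel] is functional, so two maximal paths from [q] agree step by step. *)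
Lemma root_end_uniq q e1 e2 :
  connect (root_rel E) q e1 -> (forall q', ~~ root_rel E e1 q') ->
  connect (root_rel E) q e2 -> (forall q', ~~ root_rel E e2 q') -> e1 = e2.
Proof.
move=> /connectP[s ps ->] {e1} t1 /connectP[s' ps' ->] {e2} t2.
elim: s q s' ps ps' t1 t2 => [|x s IH] q [|y s'] //=.
- by move=> _ /andP[qy _] /(_ y); rewrite qy.
- by move=> /andP[qx _] _ _ /(_ x); rewrite qx.
move=> /andP[qx ps] /andP[qy ps']; rewrite -(root_rel_fun qx qy) in ps' *.
exact: IH.
Qed.

(** Both sides are the root at the end of the chain of root labels from [q']: either [E q'] has a
    root labelled [q''] and the two chains share their end, or [q'] is its own end. *)
Lemma idfy_var q (a : E q) q' : lab a = LVar (val q') ->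
  idfy mod_E (Tagged (fun q : Q => E q) a) = sys_root mod_E q'.
Proof.
move=> la; apply: val_inj; rewrite /= /idfy_occ /occ_lab /= la /= valK.
have [ce te] := sys_endP mod_E q'.
case ql: (qlabel _) => [q''|].
  have rqq : root_rel E q' q'' by apply/eqP/qlabelP/eqP.
  congr occ_root; have [ce' te'] := sys_endP mod_E q''.
  by apply: (root_end_uniq ce te) te'; apply: connect_trans (connect1 rqq) ce'.
congr occ_root; apply: (root_end_uniq ce te (connect0 _ _)) => q''.
by apply/negP => /eqP/qlabelP; rewrite ql.
Qed.

Section NotVar.
Variable x : sys_occ E.
Hypothesis qx : qlabel Q (occ_lab x) = None.

Lemma val_idfy : val (idfy mod_E x) = x.
Proof. by rewrite /= /idfy_occ qx. Qed.

Lemma lab_idfy : lab (idfy mod_E x : Psi mod_E) = lab (tagged x).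
Proof. exact: (congr1 (@occ_lab Q E) val_idfy). Qed.

Lemma osucc_idfy : osucc (idfy mod_E x : Psi mod_E) =
  [seq idfy mod_E (Tagged (fun q : Q => E q) b) | b <- osucc (tagged x)].
Proof.
exact: (congr1 (fun y : sys_occ E =>
  [seq idfy mod_E (Tagged (fun q : Q => E q) b) | b <- osucc (tagged y)]) val_idfy).
Qed.

End NotVar.

(** The equivalence of [A_x] and [B_x] from the overview. *)
Definition occ_iff (x : sys_occ E) : formula :=
  fIff (gen (fguarded (E (tag x))) (tagged x))
       (gen (@Psi_guarded _ _ mod_E) (idfy mod_E x)).

Lemma ded_occ_iff H :
  (forall q, ded H (fIff (fVar (val q)) (E q))) ->
  (forall x, ded H (fBox (occ_iff x))) ->
  forall x, ded H (occ_iff x).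
Proof.
move=> HE Hbox [q a]; move: q a; apply: occ_ind => q a IHedge IHvar.
set x : sys_occ E := Tagged (fun q : Q => E q) a.
case ql: (qlabel Q (occ_lab x)) => [q'|].
  have la : lab a = LVar (val q') by apply/qlabelP/eqP.
  rewrite /occ_iff (idfy_var la).
  (* [A_x] is the variable [q'], equivalent by [HE] to [E q'], hence to the subformula generated by
     its root, where [IHvar] applies. *)
  apply: ded_iff_trans (ded_bisim _ (gen_atom _ (l := LVar _) erefl la)) _.
  apply: ded_iff_trans (HE q') _; apply: ded_iff_trans (IHvar _ la).
  exact/ded_bisim/gen_root_bisim.
have lx : lab (idfy mod_E x : Psi mod_E) = lab a := lab_idfy ql.
have sx : osucc (idfy mod_E x : Psi mod_E) =
    [seq idfy mod_E (Tagged (fun q : Q => E q) b) | b <- osucc a] := osucc_idfy ql.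
have iff_bisim (phi psi phi' psi' : formula) : bisimilar phi phi' ->
    bisimilar psi psi' -> ded H (fIff phi' psi') -> ded H (fIff phi psi).
  move=> b b' h; apply: ded_iff_trans (ded_bisim H b) _.
  exact: ded_iff_trans h (ded_iff_sym (ded_bisim H b')).
have IH b : ~~ is_box a -> b \in osucc a ->
    ded H (occ_iff (Tagged (fun q : Q => E q) b)).
  by move=> nb; apply: IHedge.
have nbox l : lab a = l -> l != LBox -> ~~ is_box a by rewrite /is_box => ->.
have un_case l (l1 : arity l = 1) : lab a = l ->
    (forall b, osucc a = [:: b] ->
      let y := Tagged (fun q : Q => E q) b in
      ded H (fIff (un (gen (fguarded (E q)) b) l1)
                  (un (gen (@Psi_guarded _ _ mod_E) (idfy mod_E y)) l1))) ->
    ded H (occ_iff x).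
  move=> la h; have := size_osucc a; rewrite la l1.
  case sa: (osucc a) => [|b []] // _; rewrite sa in sx.
  apply: iff_bisim (h b sa).
  + exact: gen_un.
  + exact: gen_un (etrans lx la) sx.
have bin_case l (l2 : arity l = 2) : lab a = l ->
    (forall b c, osucc a = [:: b; c] ->
      let y := Tagged (fun q : Q => E q) b in
      let z := Tagged (fun q : Q => E q) c in
      ded H (fIff (bin (gen (fguarded (E q)) b) (gen (fguarded (E q)) c) l2)
                  (bin (gen (@Psi_guarded _ _ mod_E) (idfy mod_E y))
                       (gen (@Psi_guarded _ _ mod_E) (idfy mod_E z)) l2))) ->
    ded H (occ_iff x).
  move=> la h; have := size_osucc a; rewrite la l2.
  case sa: (osucc a) => [|b [|c []]] // _; rewrite sa in sx.
  apply: iff_bisim (h b c sa).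
  + exact: gen_bin.
  + exact: gen_bin (etrans lx la) sx.
(* Leaves that are constants or variables outside [Q]: both sides are bisimilar to the same atom. *)
have [l0|] := posnP (arity (lab a)).
  apply: iff_bisim (gen_atom _ l0 erefl) (gen_atom _ l0 lx) _.
  by apply: ded_iffI; apply/ded_weak/ded_id.
case la: (lab a) => [||p|||||] // _.
- apply: (un_case LNeg erefl la) => b sa y.
  by apply: ded_iff_neg; apply: IH; rewrite ?(nbox _ la) ?sa ?inE ?eqxx.
(* Behind a box there is no induction hypothesis; [Hbox] takes its place. *)
- by apply: (un_case LBox erefl la) => b sa y; apply: ded_iff_box; exact: (Hbox y).
- apply: (bin_case LAnd erefl la) => b c sa y z.
  by apply: ded_iff_and; apply: IH; rewrite ?(nbox _ la) ?sa ?inE ?eqxx ?orbT.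
- apply: (bin_case LOr erefl la) => b c sa y z.
  by apply: ded_iff_or; apply: IH; rewrite ?(nbox _ la) ?sa ?inE ?eqxx ?orbT.
- apply: (bin_case LImp erefl la) => b c sa y z.
  by apply: ded_iff_imp; apply: IH; rewrite ?(nbox _ la) ?sa ?inE ?eqxx ?orbT.
Qed.

End System.

Theorem theorem3p9 (Q : {fset nat}) (E : system Q) (mod_E : modalised_system E) :
  CHL_entails
    [seq boxdotbul (fIff (fVar (val q)) (E q)) | q : Q]
    (fConj [seq fIff (fVar (val q)) (sys_digamma mod_E q) | q : Q]).
Proof.
rewrite /CHL_entails; set H := fConj _.
have Hq q : ded H (boxdotbul (fIff (fVar (val q)) (E q))).
  by apply: (ded_conjE (fun q => boxdotbul (fIff (fVar (val q)) (E q))));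
    rewrite mem_enum.
have HE q : ded H (fIff (fVar (val q)) (E q)).
  exact: ded_cut (Hq q) (ded_andl _ _).
(* Unfolding turns the [boxbul] part of each hypothesis into the box of that whole hypothesis. *)
have HH : ded H (fBox H).
  apply: ded_box_conj => q _; apply: ded_iff_mp (ded_bisim _ (boxbul_unfold _)) _.
  exact: ded_cut (Hq q) (ded_andr _ _).
pose D := fConj (map (occ_iff mod_E) (enum (sys_occ E))).
have DE x : ded D (occ_iff mod_E x) by apply: ded_conjE; rewrite mem_enum.
have HD : ded H D.
  apply: ded_Loeb HH _; apply: ded_conj => x _; apply: ded_occ_iff => [q|y].
    exact: ded_cut (ded_andl _ _) (HE q).
  exact: ded_cut (ded_andr _ _) (ded_box_mono (DE y)).
apply: ded_conj => q _; apply: ded_iff_trans (HE q) _.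
apply: ded_iff_trans (ded_bisim _ (gen_root_bisim _)) _.
(* [idfy] of the root occurrence of [E q] is [sys_root] by definition, so the right side of this
   conjunct of [D] is [sys_digamma]. *)
exact: ded_cut HD (DE (occ_root E q)).
Qed.
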